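(* For every $n\in\mathbb{N}$, $n\ge 1$, the pair $(D,\mathcal{T})$ is a finite complete rewriting system presenting the Chinese monoid $C_n$ of rank $n$; that is, $D$ and $\mathcal{T}$ are finite, $(D,\mathcal{T})$ is noetherian and confluent, and the presentation $\langle D\mid\mathcal{T}\rangle$ defines $C_n$ (with the symbols $d_{\alpha\beta}$ and $d_\alpha$ of $D$ representing the elements $\alpha\beta$ and $\alpha$ of $C_n$ respectively).
   Context: Let $A=\{1<2<\dots<n\}$. The Chinese monoid of rank $n$, denoted $C_n$, is the monoid presented by $\langle A\mid \mathcal{R}\rangle$ with $\mathcal{R}=\{(zyx,zxy),(zxy,yzx): x\le y\le z\}$, $x,y,z\in A$. Let $D=\{d_{\alpha\beta}:\alpha,\beta\in A,\ \alpha>\beta\}\cup\{d_\alpha:\alpha\in A\}$, where $d_{\alpha\beta}$ represents the element $\alpha\beta$ of $C_n$ and $d_\alpha$ represents the element $\alpha$ of $C_n$; thus $D$ generates $C_n$. A $D$-Chinese staircase word is a word $r^{(1)}r^{(2)}\cdots r^{(n)}$ with $r^{(k)}=d_{k1}^{\sigma_{k1}}d_{k2}^{\sigma_{k2}}\cdots d_{k(k-1)}^{\sigma_{k(k-1)}}d_k^{\sigma_k}$, where all exponents are non-negative integers. By a known result of Cassaigne et al., every element of $C_n$ is represented by exactly one $D$-Chinese staircase word; for $w\in D^*$, let $\mathrm{CS}_D(w)$ denote the unique $D$-Chinese staircase word equal to $w$ in $C_n$. Define the total order $\preceq$ on $D$ by: $d\preceq d'$ if and only if $dd'$ is a $D$-Chinese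 staircase word; $d\succ d'$ means that $d\preceq d'$ does not hold. Define the set of rewriting rules $\mathcal{T}=\{dd'\to \mathrm{CS}_D(dd') : d,d'\in D,\ d\succ d'\}$. Rewriting systems: $(X,\mathcal{T})$ consists of a finite alphabet $X$ and a set $\mathcal{T}\subseteq X^*\times X^*$ of rules $\ell\to r$; $u\to v$ in one step if $u=x\ell y$, $v=xry$ for a rule $\ell\to r$ and words $x,y$; $\to^*$ is the reflexive transitive closure. The system is finite if $X$ and $\mathcal{T}$ are finite; noetherian if there is no infinite sequence $u_1\to u_2\to\cdots$; confluent if $u\to^*u'$ and $u\to^*u''$ imply there is $v$ with $u'\to^*v$ and $u''\to^*v$; complete if it is noetherian and confluent. $\langle X\mid\mathcal{T}\rangle$ defines the quotient of $X^*$ by the congruence generated by $\mathcal{T}$. *)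

(* Defs.v *)
From Stdlib Require Export Relations.
From HB Require Import structures.
From mathcomp Require Export all_boot.
From mathcomp Require Export boolp classical_sets cardinality.

Set Implicit Arguments.
Unset Strict Implicit.
Unset Printing Implicit Defensive.

Local Open Scope classical_set_scope.

Section RewritingSystems.
Variable X : Type.

(* The rule l -> r is the pair (l, r). *)
Definition rewriting_rules := set (seq X * seq X).

Variable T : rewriting_rules.

Definition rewrites_to (u v : seq X) : Prop :=
  exists x l r y : seq X, [/\ T (l, r), u = x ++ l ++ y & v = x ++ r ++ y].

Definition rewrites_to_star : relation (seq X) :=
  clos_refl_trans (seq X) rewrites_to.

Definition noetherian : Prop :=
  ~ exists u : nat -> seq X, forall i, rewrites_to (u i) (u i.+1).

Definition confluent : Prop :=
  forall u u' u'', rewrites_to_star u u' -> rewrites_to_star u u'' ->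
    exists v, rewrites_to_star u' v /\ rewrites_to_star u'' v.

Inductive word_congruence : seq X -> seq X -> Prop :=
| wc_rule l r : T (l, r) -> word_congruence l r
| wc_refl u : word_congruence u u
| wc_sym u v : word_congruence u v -> word_congruence v u
| wc_trans v u w :
    word_congruence u v -> word_congruence v w -> word_congruence u w
| wc_cat u u' v v' : word_congruence u u' -> word_congruence v v' ->
    word_congruence (u ++ v) (u' ++ v').

End RewritingSystems.

Section Presentation.
Variables (X : choiceType) (T : rewriting_rules X).

Definition word_congruenceb : rel (seq X) :=
  fun u v => `[< word_congruence T u v >].

Lemma word_congruenceb_refl : reflexive word_congruenceb.
Proof. by move=> u; apply/asboolP; apply: wc_refl. Qed.

Lemma word_congruenceb_sym : symmetric word_congruenceb.
Proof. by move=> u v; apply/asboolP/asboolP; apply: wc_sym. Qed.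

Lemma word_congruenceb_trans : transitive word_congruenceb.
Proof.
by move=> v u w /asboolP uv /asboolP vw; apply/asboolP; apply: wc_trans uv vw.
Qed.

Canonical word_congruence_equiv :=
  EquivRel word_congruenceb word_congruenceb_refl word_congruenceb_sym
    word_congruenceb_trans.

Local Open Scope quotient_scope.

Definition presented_monoid := {eq_quot word_congruence_equiv}.

HB.instance Definition _ := Choice.on presented_monoid.
HB.instance Definition _ := EqQuotient.on presented_monoid.

Definition word_class (u : seq X) : presented_monoid := \pi_presented_monoid u.

Definition generator (a : X) : presented_monoid := word_class [:: a].

Definition presented_one : presented_monoid := word_class [::].

Definition presented_mul (p q : presented_monoid) : presented_monoid :=
  word_class (repr p ++ repr q).

Lemma word_classP u v : word_class u = word_class v <-> word_congruence T u v.
Proof. by split=> [/eqquotP/asboolP|uv]; last exact/eqquotP/asboolP. Qed.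

Lemma word_class_repr p : word_class (repr p) = p.
Proof. exact: reprK. Qed.

Lemma presented_mulE u v :
  presented_mul (word_class u) (word_class v) = word_class (u ++ v).
Proof.
by apply/word_classP/wc_cat; apply/word_classP; rewrite word_class_repr.
Qed.

Lemma presented_mulA : associative presented_mul.
Proof.
move=> p q r; rewrite -(word_class_repr p) -(word_class_repr q).
by rewrite -(word_class_repr r) !presented_mulE catA.
Qed.

Lemma presented_mul1 : left_id presented_one presented_mul.
Proof. by move=> p; rewrite -(word_class_repr p) presented_mulE. Qed.

Lemma presented_mulr1 : right_id presented_one presented_mul.
Proof. by move=> p; rewrite -(word_class_repr p) presented_mulE cats0. Qed.

HB.instance Definition _ :=
  isMonoid.Build presented_monoid presented_mulA presented_mul1 presented_mulr1.

End Presentation.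

Section ChineseMonoid.
Variable n : nat.

(* The alphabet 1 < ... < n is represented by 'I_n, that is by 0 < ... < n-1. *)
Definition chinese_relations : rewriting_rules 'I_n :=
  [set p | exists x y z : 'I_n, x <= y <= z /\
     (p = ([:: z; y; x], [:: z; x; y]) \/ p = ([:: z; x; y], [:: y; z; x]))].

Definition chinese_monoid := presented_monoid chinese_relations.

HB.instance Definition _ := Monoid.on chinese_monoid.

(* The left summand consists of the pairs (a, b) with b < a, the condition
   being carried by the type 'I_a of b. *)
Definition Dsym : finType := ({a : 'I_n & 'I_a} + 'I_n)%type.

Definition d2 (a : 'I_n) (b : 'I_a) : Dsym :=
  inl (Tagged (fun a : 'I_n => 'I_a) b).

Definition d1 (a : 'I_n) : Dsym := inr a.

Definition Dval (d : Dsym) : chinese_monoid :=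
  match d with
  | inl (existT a b) =>
      (generator chinese_relations a *
       generator chinese_relations (widen_ord (ltnW (ltn_ord a)) b))%g
  | inr a => generator chinese_relations a
  end.

Definition Dword_val (w : seq Dsym) : chinese_monoid :=
  (\prod_(d <- w) Dval d)%g.

(* The exponents are given by a function s on the symbols. *)
Definition staircase_row (s : Dsym -> nat) (k : 'I_n) : seq Dsym :=
  flatten [seq nseq (s (d2 j)) (d2 j) | j <- enum 'I_k]
    ++ nseq (s (d1 k)) (d1 k).

Definition staircase (w : seq Dsym) : Prop :=
  exists s : Dsym -> nat, w = flatten [seq staircase_row s k | k <- enum 'I_n].

(* Every element of the Chinese monoid is represented by exactly one staircase
   word (Cassaigne et al.), so the default value [::] is never used and the
   choice made by xget is forced. *)
Definition CSD (w : seq Dsym) : seq Dsym :=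
  xget [::] [set v | staircase v /\ Dword_val v = Dword_val w].

Definition Dle (d d' : Dsym) : Prop := staircase [:: d; d'].

Definition staircase_rules : rewriting_rules Dsym :=
  [set p | exists d d' : Dsym,
     ~ Dle d d' /\ p = ([:: d; d'], CSD [:: d; d'])].

End ChineseMonoid.

Arguments chinese_relations : clear implicits.
Arguments staircase_rules : clear implicits.

(* Main.v *)
Require Import Defs.
From mathcomp Require Import zify.

Set Implicit Arguments.
Unset Strict Implicit.
Unset Printing Implicit Defensive.

(**
Homomorphisms to the bicyclic monoid, generated by [p] and [q] with [pq = 1],
tell staircase words apart.  For thresholds [i <= j], send the letters below [i]
to [q], the letters from [j] on to [p], and those in between to [1]; the Chinese
relations hold in the image because [ppq = pqp = p] and [pqq = qpq = q].
Reading [p] and [q] as opening and closing brackets, the image of a word records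
how many brackets it matches.  A staircase word is sorted by the larger letters
of its symbols.  So once a symbol has opened a bracket, every later symbol has a
larger letter that opens one as well, and if its smaller letter closes a bracket
it is that one.  The number of matches is therefore the number of symbols [d_ab] with
[b < i] and [j <= a].  By inclusion and exclusion on [i] and [j] these numbers
determine the exponent of each [d_ab], and the number of occurrences of each
letter then gives the exponents of the [d_a].  Hence a staircase word is
determined by its value ([staircase_unique]), which is the uniqueness part of
the theorem of Cassaigne et al.

Any two symbols in the wrong order have the value of an explicit staircase word
that begins with a strictly smaller symbol than they do
([staircase_pair_exists]).  By uniqueness that word is the right-hand side
of the rule.  So a rewriting step lowers the word lexicographically.  Since
it keeps the number of letters of the value and each symbol has at least one
letter, only finitely many words are available, and rewriting terminates
([rewrites_to_code]).

The irreducible words are the staircase words and the rules preserve the value.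
So two words of the same value reduce to the same staircase word
([same_value_joinable]): this gives confluence, and it also shows that
evaluation is injective on the monoid presented by the rules.  Evaluation
is surjective because the symbols [d_a] already generate.
*)

(** * Rewriting systems with value-separated normal forms *)

Section Rewriting.
Variables (X : Type) (T : rewriting_rules X).

Lemma rewrites_to_congruence u v : rewrites_to T u v -> word_congruence T u v.
Proof.
move=> [x [l [r [y [Tlr -> ->]]]]].
by do 2?apply: wc_cat; by [apply: wc_refl | apply: wc_rule].
Qed.

Lemma rewrites_to_star_congruence u v :
  rewrites_to_star T u v -> word_congruence T u v.
Proof.
elim=> [{}u {}v /rewrites_to_congruence//|{}u|{}u v' {}v _ uv _ vw].
  exact: wc_refl.
exact: wc_trans uv vw.
Qed.

Variable mu : seq X -> nat.
Hypothesis mu_lt : forall u v, rewrites_to T u v -> mu v < mu u.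

Lemma noetherian_measure : noetherian T.
Proof.
move=> [u ustep].
have bound i : mu (u i) + i <= mu (u 0).
  elim: i => [|i IHi]; first by rewrite addn0.
  by have := mu_lt (ustep i); lia.
by have := bound (mu (u 0)).+1; lia.
Qed.

Variable nf : seq X -> Prop.
Hypothesis reducible : forall u, ~ nf u -> exists v, rewrites_to T u v.

Lemma normal_form_exists u : exists2 v, rewrites_to_star T u v & nf v.
Proof.
have [m] := ubnP (mu u); elim: m u => // m IHm u lt_um.
case: (EM (nf u)) => [nfu|/reducible[v uv]].
  by exists u => //; apply: rt_refl.
have [|w vw nfw] := IHm v; first by have := mu_lt uv; lia.
by exists w => //; apply: rt_trans vw; apply: rt_step.
Qed.

Variables (V : Type) (val : seq X -> V).
Hypothesis val_congruence :
  forall u v, word_congruence T u v -> val u = val v.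
Hypothesis nf_inj : forall u v, nf u -> nf v -> val u = val v -> u = v.

(** Confluence and completeness of the presentation both come from here: the
value alone decides which normal form is reached. *)
Lemma same_value_joinable u v : val u = val v ->
  exists w, rewrites_to_star T u w /\ rewrites_to_star T v w.
Proof.
move=> uv; have [u' uu' nfu] := normal_form_exists u.
have [v' vv' nfv] := normal_form_exists v.
exists u'; split=> //; suff -> : u' = v' by [].
apply: nf_inj => //.
rewrite -(val_congruence (rewrites_to_star_congruence uu')) uv.
exact/val_congruence/rewrites_to_star_congruence.
Qed.

Lemma normal_forms_confluent : confluent T.
Proof.
move=> u u' u'' uu' uu''; apply: same_value_joinable.
rewrite -(val_congruence (rewrites_to_star_congruence uu')).
exact/val_congruence/rewrites_to_star_congruence.
Qed.

Lemma same_value_congruence u v : val u = val v -> word_congruence T u v.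
Proof.
move/same_value_joinable=> [w [uw vw]].
apply: wc_trans (rewrites_to_star_congruence uw) _.
exact/wc_sym/rewrites_to_star_congruence.
Qed.

End Rewriting.

(** * Staircase words as sorted words *)

Section Symbols.
Variable n : nat.
Implicit Types (a b c : 'I_n) (d e : Dsym n) (v w : seq (Dsym n)).

Definition letters d : seq 'I_n :=
  match d with
  | inl (existT a b) => [:: a; widen_ord (ltnW (ltn_ord a)) b]
  | inr a => [:: a]
  end.

Definition top d : 'I_n :=
  match d with inl (existT a _) => a | inr a => a end.

Definition bot d : 'I_n :=
  match d with
  | inl (existT a b) => widen_ord (ltnW (ltn_ord a)) b
  | inr a => a
  end.

(** A uniform constructor: [sym a b] is [d_ab] when [b < a], and [sym a a] is
[d_a].  The staircase order on symbols becomes the lexicographic order on these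
pairs of letters. *)
Definition sym a b : Dsym n :=
  if insub (b : nat) is Some j then d2 (j : 'I_a) else d1 a.

Lemma top_sym a b : top (sym a b) = a.
Proof. by rewrite /sym; case: insubP. Qed.

Lemma bot_sym a b : b <= a -> bot (sym a b) = b.
Proof.
rewrite /sym; case: insubP => [j _ jb _|]; first exact: val_inj.
by move=> ? ?; apply: val_inj => /=; lia.
Qed.

Lemma letters_sym a b : b < a -> letters (sym a b) = [:: a; b].
Proof.
rewrite /sym; case: insubP => [j _ jb _|/negP//].
by congr [:: a; _]; apply: val_inj.
Qed.

Lemma sym_diag a : sym a a = d1 a.
Proof. by rewrite /sym; case: insubP => //; rewrite ltnn. Qed.

Lemma letters_d1 a : letters (d1 a) = [:: a]. Proof. by []. Qed.

Variant sym_spec : Dsym n -> Prop :=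
  | SymSingle a : sym_spec (d1 a)
  | SymPair a b of b < a : sym_spec (sym a b).

Lemma symP d : sym_spec d.
Proof.
case: d => [[a b]|a]; last exact: SymSingle.
have ba : widen_ord (ltnW (ltn_ord a)) b < a by exact: ltn_ord b.
suff -> : inl (existT _ a b) = sym a (widen_ord (ltnW (ltn_ord a)) b).
  exact: SymPair.
rewrite /sym; case: insubP => [j _ jb|/negP//].
by congr (inl (existT _ a _)); apply: val_inj.
Qed.

Lemma bot_le_top d : bot d <= top d.
Proof. by case: (symP d) => // a b ba; rewrite top_sym bot_sym ltnW. Qed.

Lemma sym_top_bot d : sym (top d) (bot d) = d.
Proof.
case: (symP d) => [a|a b ba]; first exact: sym_diag.
by rewrite top_sym bot_sym // ltnW.
Qed.

(** A base-[n] encoding of the pair (top, bot), which makes the lexicographic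
order an order on numbers. *)
Definition rank d := top d * n + bot d.

Lemma rank_lt d e :
  (rank d < rank e) = (top d < top e) || ((top d == top e) && (bot d < bot e)).
Proof.
rewrite /rank; have := ltn_ord (bot d); have := ltn_ord (bot e).
case: (ltngtP (top d) (top e)) => [lt|lt|/val_inj ->] ? ? /=; last first.
- by rewrite eqxx /= ltn_add2l.
- rewrite -val_eqE /= gtn_eqF //=; apply/negbTE; rewrite -leqNgt.
  by have := leq_mul2r n (top e).+1 (top d); rewrite lt orbT mulSn; lia.
- by have := leq_mul2r n (top d).+1 (top e); rewrite lt orbT mulSn; lia.
Qed.

Lemma rank_le d e :
  (rank d <= rank e) = (top d < top e) || ((top d == top e) && (bot d <= bot e)).
Proof.
rewrite leqNgt rank_lt -!val_eqE /=; lia.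
Qed.

Lemma rank_inj : injective rank.
Proof.
move=> d e /eqP; rewrite eqn_leq !rank_le -!val_eqE /= => de.
rewrite -(sym_top_bot d) -(sym_top_bot e).
by congr sym; apply: val_inj => /=; lia.
Qed.

Lemma rank_bound d : rank d < n * n.
Proof.
have := ltn_ord (bot d); have := leq_mul2r n (top d).+1 n.
by rewrite (ltn_ord (top d)) orbT mulSn /rank; lia.
Qed.

Definition rle : rel (Dsym n) := relpre rank leq.

Lemma rle_trans : transitive rle.
Proof. by move=> d e f; apply: leq_trans. Qed.

Lemma rle_anti : antisymmetric rle.
Proof. by move=> d e; rewrite /rle /= -eqn_leq => /eqP/rank_inj. Qed.

Lemma rle_top d e : rle d e -> top d <= top e.
Proof. by rewrite /rle /= rank_le -val_eqE /=; lia. Qed.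

Lemma pairwise_flatten (A B : Type) (r : rel B) (F : A -> seq B) s :
  all (fun x => pairwise r (F x)) s ->
  pairwise (fun x y => allrel r (F x) (F y)) s ->
  pairwise r (flatten (map F s)).
Proof.
elim: s => //= x s IHs /andP[Fx Fs] /andP[xs ss].
rewrite pairwise_cat Fx IHs // !andbT.
elim: s xs {Fs ss IHs} => [|y s IHs] /=; first by rewrite allrel0r.
by move=> /andP[xy xs]; rewrite allrel_catr xy IHs.
Qed.

(** All the symbols in increasing order: a staircase word is a product of powers
along this list. *)
Definition symbols : seq (Dsym n) :=
  flatten [seq rcons [seq d2 j | j <- enum 'I_a] (d1 a) | a <- enum 'I_n].

Lemma staircaseE (s : Dsym n -> nat) :
  flatten [seq staircase_row s a | a <- enum 'I_n] =
  flatten [seq nseq (s d) d | d <- symbols].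
Proof.
rewrite /symbols; elim: (enum 'I_n) => //= a t ->.
rewrite map_cat flatten_cat; congr (_ ++ _).
by rewrite /staircase_row map_rcons -cats1 flatten_cat /= cats0 -map_comp.
Qed.

Lemma pairwise_enum_ord m : pairwise (fun i j : 'I_m => i < j) (enum 'I_m).
Proof.
rewrite -(pairwise_map val ltn) val_enum_ord -sorted_pairwise ?iota_ltn_sorted //.
exact: ltn_trans.
Qed.

Lemma symbols_sorted : pairwise (fun d e => rank d < rank e) symbols.
Proof.
apply: pairwise_flatten.
  apply/allP=> a _; rewrite -cats1 pairwise_cat /= andbT; apply/andP; split.
    apply/allrelP=> d e /mapP[j _ ->]; rewrite inE => /eqP->.
    by rewrite rank_lt eqxx /= ltn_ord orbT.
  rewrite pairwise_map; apply: sub_pairwise (pairwise_enum_ord a) => j k jk.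
  by rewrite /= rank_lt eqxx /= jk orbT.
have topF a d : d \in rcons [seq d2 j | j <- enum 'I_a] (d1 a) -> top d = a.
  by rewrite mem_rcons inE => /predU1P[->|/mapP[j _ ->]].
apply: sub_pairwise (pairwise_enum_ord n) => a b ab.
by apply/allrelP=> d e /topF da /topF eb; rewrite rank_lt da eb ab.
Qed.

Lemma symbols_uniq : uniq symbols.
Proof.
rewrite -(map_inj_uniq rank_inj); apply: (sorted_uniq ltn_trans ltnn).
by rewrite sorted_pairwise ?pairwise_map ?symbols_sorted //; exact: ltn_trans.
Qed.

Lemma mem_symbols d : d \in symbols.
Proof.
apply/flatten_mapP; case: d => [[a b]|a]; exists a; rewrite ?mem_enum //.
  by rewrite mem_rcons inE; apply/orP; right; apply: map_f; rewrite mem_enum.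
by rewrite mem_rcons mem_head.
Qed.

Lemma count_powers (s : Dsym n -> nat) d :
  count_mem d (flatten [seq nseq (s e) e | e <- symbols]) = s d.
Proof.
rewrite count_flatten -map_comp.
rewrite (eq_map (_ : _ =1 fun e => (e == d) * s e)); last first.
  by move=> e /=; rewrite count_nseq.
rewrite sumnE big_map (bigD1_seq d) ?mem_symbols ?symbols_uniq //= eqxx mul1n.
by rewrite big1 ?addn0 // => e /negbTE->.
Qed.

Lemma powers_sorted (s : Dsym n -> nat) :
  sorted rle (flatten [seq nseq (s e) e | e <- symbols]).
Proof.
rewrite sorted_pairwise; last exact: rle_trans.
apply: pairwise_flatten.
  apply/allP=> d _; elim: (s d) => //= k ->; rewrite andbT.
  by apply/allP=> e /nseqP[-> _]; rewrite /rle /=.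
apply: sub_pairwise symbols_sorted => d e /= de.
by apply/allrelP=> x y /nseqP[-> _] /nseqP[-> _]; apply: ltnW.
Qed.

(** A sorted word is determined by its multiplicities, and these can serve as the
exponents. *)
Lemma staircaseP w : staircase w <-> sorted rle w.
Proof.
split=> [[s ->]|w_sorted]; first by rewrite staircaseE powers_sorted.
exists (fun d => count_mem d w); rewrite staircaseE.
apply: (sorted_eq rle_trans rle_anti) => //; first exact: powers_sorted.
by apply/allP=> d _; rewrite /= count_powers.
Qed.

(** * Invariants of the Chinese monoid *)

Definition spell w : seq 'I_n := flatten (map letters w).

Lemma spell_cat v w : spell (v ++ w) = spell v ++ spell w.
Proof. by rewrite /spell map_cat flatten_cat. Qed.

Lemma size_spell w : size w <= size (spell w).
Proof.
elim: w => //= d w IHw; rewrite /spell /= size_cat -/(spell w).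
by case: d => [[a b]|a] /=; lia.
Qed.

Lemma Dword_val_class w : Dword_val w = word_class (chinese_relations n) (spell w).
Proof.
rewrite /Dword_val; elim: w => [|d w IHw]; first by rewrite big_nil.
rewrite big_cons IHw /spell /=.
have -> : Dval d = word_class (chinese_relations n) (letters d).
  by case: d => [[a b]|a] //=; rewrite /generator; exact: presented_mulE.
exact: presented_mulE.
Qed.

Lemma Dword_valP v w :
  Dword_val v = Dword_val w <->
  word_congruence (chinese_relations n) (spell v) (spell w).
Proof. by rewrite !Dword_val_class word_classP. Qed.

Lemma Dword_val_cat v w : Dword_val (v ++ w) = (Dword_val v * Dword_val w)%g.
Proof. by rewrite /Dword_val big_cat. Qed.

Lemma chinese_perm (u v : seq 'I_n) :
  word_congruence (chinese_relations n) u v -> perm_eq u v.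
Proof.
elim=> {u v} [l r|u|u v _|v u w _ uv _ vw|u u' v v' _ uu' _ vv'].
- move=> [x [y [z [_ [] [-> ->]]]]].
    by rewrite perm_cons -(perm_rot 1 [:: y; x]).
  by rewrite -(perm_rot 2 [:: z; x; y]).
- exact: perm_refl.
- by rewrite perm_sym.
- exact: perm_trans uv vw.
- exact: perm_cat.
Qed.

(** Right multiplication by the image of a letter in the bicyclic monoid, where
the state [(s, t)] stands for [q ^ s * p ^ t]: a letter [q] cancels a pending
[p] if there is one. *)
Definition bracket_step (i j : nat) (s : nat * nat) a : nat * nat :=
  if a < i then (if s.2 is t.+1 then (s.1, t) else (s.1.+1, 0))
  else if j <= a then (s.1, s.2.+1) else s.

(** The thresholds must satisfy [i <= j]: otherwise a letter would have to be
both a [p] and a [q]. The inequalities below say that in [x <= y <= z] every [q]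
is smaller than every [p], so that only a few images of [(x, y, z)] occur. *)
Lemma bracket_congruence i j (u v : seq 'I_n) : i <= j ->
  word_congruence (chinese_relations n) u v ->
  forall s, foldl (bracket_step i j) s u = foldl (bracket_step i j) s v.
Proof.
move=> ij; elim=> {u v} [l r lr|u|u v _ uv|v u w _ uv _ vw|u u' v v' _ uu' _ vv'] s.
- case: lr s => [x [y [z [/andP[xy yz] lr]]]] [p q].
  have zi : z < i -> y < i := leq_ltn_trans yz.
  have yi : y < i -> x < i := leq_ltn_trans xy.
  have xj jx : j <= y := leq_trans jx xy.
  have yj jy : j <= z := leq_trans jy yz.
  have xij : x < i -> (j <= x) = false by clear lr; lia.
  have yij : y < i -> (j <= y) = false by clear lr; lia.
  have zij : z < i -> (j <= z) = false by clear lr; lia.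
  by case: lr => [] [-> ->] /=; rewrite /bracket_step;
    case: (ltnP x i) xij yi => ?; case: (ltnP y i) yij zi => ?;
    case: (ltnP z i) zij => ?;
    case: (leqP j x) xj => ?; case: (leqP j y) yj => ?;
    case: (leqP j z) => ? //=; do ?[by lia | move=> _];
    case: q => [|[|q]].
- by [].
- by rewrite uv.
- by rewrite uv vw.
- by rewrite !foldl_cat uu' vv'.
Qed.

(** The symbols that open and close a bracket at once. *)
Definition straddles (i j : nat) d := (bot d < i) && (j <= top d).

(** Once a bracket is pending, some symbol with top at least [j] has been read, so
all the following ones have top at least [j] too.  Such a symbol closes
at most one bracket and opens one first.  Hence every [q] that does not belong to
a straddling symbol stays unmatched and is counted by the first component. *)
Lemma bracket_sorted i j w s : i <= j -> sorted rle w ->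
  s.2 = 0 \/ all (fun d => j <= top d) w ->
  (foldl (bracket_step i j) s (spell w)).1 + count (straddles i j) w =
  s.1 + count (fun a : 'I_n => a < i) (spell w).
Proof.
move=> ij; elim: w s => [|d w IHw] [p q] //=.
rewrite path_sortedE; last exact: rle_trans.
move=> /andP[dw w_sorted] pq.
have top_w : j <= top d -> all (fun e => j <= top e) w.
  by move=> jd; apply: sub_all dw => e /rle_top; apply: leq_trans.
have q0 : top d < j -> q = 0.
  by case: pq => //= /andP[jd _]; lia.
have {}pq : q = 0 \/ all (fun e => j <= top e) w.
  by case: pq => [->|/andP[_ ?]]; [left | right].
rewrite /spell /= foldl_cat -/(spell w) count_cat.
have IH q' (h : q' = 0 \/ all (fun e => j <= top e) w) p' :=
  IHw (p', q') w_sorted h.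
move: (count (straddles i j) w) (count _ (spell w)) IH => M Q /= IH.
rewrite [straddles i j d]/straddles.
have bracketE p' q' a : bracket_step i j (p', q') a =
  if a < i then (if q' is t.+1 then (p', t) else (p'.+1, 0))
  else if j <= a then (p', q'.+1) else (p', q') by [].
case: (symP d) top_w q0 => [a|a b ba].
  rewrite letters_d1 [top _]/= [bot _]/= [foldl _ _ [:: a]]/= bracketE /=.
  case: (leqP j a) => [ja /(_ isT) w_top _|aj _ /(_ isT) q0].
    have -> : (a < i) = false by lia.
    by have := IH q.+1 (or_intror w_top) p; lia.
  rewrite {}q0 andbF; case: ltnP => _ /=.
    by have := IH 0 (or_introl erefl) p.+1; lia.
  by have := IH 0 (or_introl erefl) p; lia.
rewrite letters_sym // top_sym bot_sym ?(ltnW ba) // [foldl _ _ [:: a; b]]/=.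
rewrite !bracketE /=.
case: (leqP j a) => [ja /(_ isT) w_top _|aj _ /(_ isT) q0].
  have -> : (a < i) = false by lia.
  rewrite bracketE; case: (ltnP b i) => bi /=.
    by have := IH q (or_intror w_top) p; lia.
  case: (leqP j b) => jb; first by have := IH q.+2 (or_intror w_top) p; lia.
  by have := IH q.+1 (or_intror w_top) p; lia.
have bj : (j <= b) = false by lia.
rewrite {}q0 andbF; case: (ltnP a i) => ai; rewrite bracketE ?bj.
  have -> : b < i by lia.
  by have := IH 0 (or_introl erefl) p.+2; lia.
case: (ltnP b i) => bi; first by have := IH 0 (or_introl erefl) p.+1; lia.
by have := IH 0 (or_introl erefl) p; lia.
Qed.

(** * Uniqueness of staircase words *)

Lemma straddles_count v w i j : i <= j -> sorted rle v -> sorted rle w ->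
  word_congruence (chinese_relations n) (spell v) (spell w) ->
  count (straddles i j) v = count (straddles i j) w.
Proof.
move=> ij v_sorted w_sorted vw.
have := bracket_sorted ij w_sorted (or_introl erefl : (0, 0).2 = 0 \/ _).
have := bracket_sorted ij v_sorted (or_introl erefl : (0, 0).2 = 0 \/ _).
rewrite (bracket_congruence ij vw) (permP (chinese_perm vw)) => <-.
by move/addnI.
Qed.

Lemma sym_eqE d a b : b <= a -> (d == sym a b) = (top d == a) && (bot d == b).
Proof.
move=> ba; apply/eqP/andP => [->|[/eqP<- /eqP<-]]; last by rewrite sym_top_bot.
by rewrite top_sym bot_sym // !eqxx.
Qed.

(** Inclusion and exclusion on the quadrants [bot < i], [j <= top]; the condition
[b < a] puts all four corners in the range [i <= j]. *)
Lemma count_pair w a b : b < a ->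
  count (straddles b.+1 a) w + count (straddles b a.+1) w =
  count (straddles b a) w + count (straddles b.+1 a.+1) w
    + count_mem (sym a b) w.
Proof.
move=> ba; elim: w => //= d w IHw.
have : (straddles b.+1 a d) + (straddles b a.+1 d) =
    (straddles b a d) + (straddles b.+1 a.+1 d) + (d == sym a b).
  rewrite sym_eqE ?(ltnW ba) // /straddles -!val_eqE /=; lia.
by rewrite addnACA IHw => ->; rewrite addnACA; congr (_ + _); apply: addnACA.
Qed.

Definition is_pair d := bot d < top d.

Lemma count_letter w a :
  count_mem a (spell w) = count_mem (d1 a) w +
    sumn [seq count_mem a (letters d) | d <- w & is_pair d].
Proof.
elim: w => //= d w IHw; rewrite /spell /= count_cat -/(spell w) IHw.
rewrite /is_pair; case: (symP d) => [b|b c cb].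
  have -> : (d1 b == d1 a) = (b == a) by [].
  by rewrite ltnn /= addn0 addnA.
rewrite top_sym bot_sym ?(ltnW cb) // cb letters_sym //= -sym_diag sym_eqE //.
rewrite top_sym bot_sym ?(ltnW cb) //.
suff -> : (b == a) && (c == a) = false by rewrite add0n addnCA letters_sym.
by apply/negP=> /andP[/eqP ba /eqP ca]; move: cb; rewrite ba ca ltnn.
Qed.

(** The invariants [straddles] give the multiplicities of the pairs, and the
contents then leave only one possibility for the single letters. *)
Theorem staircase_unique v w :
  staircase v -> staircase w -> Dword_val v = Dword_val w -> v = w.
Proof.
move=> /staircaseP v_sorted /staircaseP w_sorted /Dword_valP vw.
apply: (sorted_eq rle_trans rle_anti) => //.
have pairs d : is_pair d -> count_mem d v = count_mem d w.
  case: (symP d) => [a|a b ba _]; first by rewrite /is_pair ltnn.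
  have E i j ij := @straddles_count v w i j ij v_sorted w_sorted vw.
  have := count_pair v ba; rewrite !E ?count_pair //; lia.
have pairs_perm : perm_eq (filter is_pair v) (filter is_pair w).
  apply/allP=> d _; rewrite /= !count_filter; apply/eqP.
  case: (boolP (is_pair d)) => d_pair.
    rewrite !(@eq_count _ (predI _ _) (pred1 d)) ?pairs // => e /=;
      by case: eqP => // ->.
  rewrite !(@eq_count _ (predI _ _) pred0) ?count_pred0 // => e /=;
    by case: eqP => // ->; apply: negbTE.
apply/allP=> d _ /=; apply/eqP; case: (symP d) => [a|a b ba]; last first.
  by apply: pairs; rewrite /is_pair top_sym bot_sym // ltnW.
have := permP (chinese_perm vw) (pred1 a); rewrite !count_letter.
rewrite (perm_sumn (perm_map (fun d => count_mem a (letters d)) pairs_perm)).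
exact: addIn.
Qed.

(** * Straightening two symbols *)

Local Notation gen := (generator (chinese_relations n)).

Lemma gen3 (x y z : 'I_n) :
  (gen x * gen y * gen z : chinese_monoid n)%g =
  word_class (chinese_relations n) [:: x; y; z].
Proof.
by rewrite -(presented_mulE _ [:: x; y] [:: z]) -(presented_mulE _ [:: x] [:: y]).
Qed.

(** The relations are stated with a right factor [m] and with [y z x] as common
target, so that they rewrite inside right-nested products. *)
Lemma gen_zyx (x y z : 'I_n) (m : chinese_monoid n) : x <= y -> y <= z ->
  (gen z * (gen y * (gen x * m)) = gen y * (gen z * (gen x * m)))%g.
Proof.
move=> xy yz; rewrite !mulgA; congr (_ * m)%g.
rewrite !gen3; apply/word_classP.
apply: (wc_trans (v := [:: z; x; y])); apply: wc_rule; exists x, y, z.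
  by split; [rewrite xy | left].
by split; [rewrite xy | right].
Qed.

Lemma gen_zxy (x y z : 'I_n) (m : chinese_monoid n) : x <= y -> y <= z ->
  (gen z * (gen x * (gen y * m)) = gen y * (gen z * (gen x * m)))%g.
Proof.
move=> xy yz; rewrite !mulgA; congr (_ * m)%g.
rewrite !gen3; apply/word_classP.
by apply: wc_rule; exists x, y, z; split; [rewrite xy | right].
Qed.

Lemma Dval_diag a : Dval (sym a a) = gen a.
Proof. by rewrite sym_diag. Qed.

Lemma Dval_pair a b : b < a -> Dval (sym a b) = (gen a * gen b)%g.
Proof.
rewrite /sym; case: insubP => [j _ jb _|/negP//] /=.
by congr (_ * gen _)%g; apply: val_inj.
Qed.

Lemma DvalM a b m : b < a ->
  (Dval (sym a b) * m = gen a * (gen b * m))%g.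
Proof. by move=> ba; rewrite Dval_pair // mulgA. Qed.

Lemma rank_sym_lt a b a' b' : b <= a -> b' <= a' ->
  (rank (sym a b) < rank (sym a' b')) =
  (a < a') || ((a == a' :> nat) && (b < b')).
Proof. by move=> ba ba'; rewrite rank_lt !top_sym !bot_sym. Qed.

Lemma rank_sym_le a b a' b' : b <= a -> b' <= a' ->
  (rank (sym a b) <= rank (sym a' b')) =
  (a < a') || ((a == a' :> nat) && (b <= b')).
Proof. by move=> ba ba'; rewrite rank_le !top_sym !bot_sym. Qed.

Lemma Dword_val_cons d w : Dword_val (d :: w) = (Dval d * Dword_val w)%g.
Proof. by rewrite /Dword_val big_cons. Qed.

Lemma DleP d d' : Dle d d' <-> rank d <= rank d'.
Proof. by rewrite /Dle staircaseP /= andbT. Qed.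

(** Symbols with the same larger letter commute.  Otherwise the relations let
the largest letter join the smallest one, and the remaining letters move in front
of them.  The only product of three symbols arises from
[d_ab d_bc = d_b d_b d_ac], so rules need not shorten words, but the first
symbol always gets smaller: this is what termination rests on. *)
Lemma staircase_pair_exists d d' : ~ Dle d d' -> exists e v,
  [/\ rank e < rank d, staircase (e :: v)
    & Dword_val (e :: v) = Dword_val [:: d; d']].
Proof.
move=> /DleP/negP; rewrite -ltnNge.
rewrite -(sym_top_bot d) -(sym_top_bot d').
have := bot_le_top d; have := bot_le_top d'.
move: (top d) (bot d) (top d') (bot d') => a b a' b' {d d'} ba' ba.
rewrite rank_sym_lt // => lt.
set G := ex _.
have D1 e : rank e < rank (sym a b) ->
    Dword_val [:: e] = Dword_val [:: sym a b; sym a' b'] -> G.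
  by move=> ea ev; rewrite /G; exists e, [::]; split=> //; apply/staircaseP.
have D2 e f : rank e < rank (sym a b) -> rank e <= rank f ->
    Dword_val [:: e; f] = Dword_val [:: sym a b; sym a' b'] -> G.
  by move=> ea ef ev; rewrite /G; exists e, [:: f]; split=> //; apply/DleP.
have D3 e f g : rank e < rank (sym a b) -> rank e <= rank f ->
    rank f <= rank g ->
    Dword_val [:: e; f; g] = Dword_val [:: sym a b; sym a' b'] -> G.
  move=> ea ef fg ev; rewrite /G; exists e, [:: f; g]; split=> //.
  by apply/staircaseP; rewrite /= /rle /= ef fg.
(* From here on, a symbol is a single letter or a pair with [b < a]; [lt] says
   that the second symbol is the smaller one. *)
have [ba1|ba1] := leqP a b; have [ba2|ba2] := leqP a' b';
  try (have {ba}ba1 : b = a by apply: val_inj => /=; lia);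
  try (have {ba'}ba2 : b' = a' by apply: val_inj => /=; lia);
  try subst b; try subst b'.
- apply: (D1 (sym a a')); first by rewrite rank_sym_lt; lia.
  by rewrite !Dword_val_cons !Dval_diag Dval_pair ?mulgA //; lia.
- case: (ltnP a' a) => [a'a|aa'].
    apply: (D2 (sym a' a') (sym a b')).
    + by rewrite rank_sym_lt; lia.
    + by rewrite rank_sym_le; lia.
    rewrite !Dword_val_cons !Dval_diag !DvalM; try lia.
    by rewrite [RHS]gen_zyx //; lia.
  have {lt}aa' : a = a' by apply: val_inj => /=; lia.
  subst a'; apply: (D2 (sym a b') (sym a a)).
  + by rewrite rank_sym_lt; lia.
  + by rewrite rank_sym_le; lia.
  rewrite !Dword_val_cons !Dval_diag !DvalM; try lia.
  by rewrite [LHS]gen_zxy //; lia.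
- case: (leqP b a') => ba''.
    apply: (D2 (sym a' a') (sym a b)).
    + by rewrite rank_sym_lt; lia.
    + by rewrite rank_sym_le; lia.
    rewrite !Dword_val_cons !Dval_diag !DvalM; try lia.
    by rewrite [RHS]gen_zxy //; lia.
  apply: (D2 (sym b b) (sym a a')).
  + by rewrite rank_sym_lt; lia.
  + by rewrite rank_sym_le; lia.
  rewrite !Dword_val_cons !Dval_diag !DvalM; try lia.
  by rewrite [RHS]gen_zyx //; lia.
- case: (ltnP a' a) => [a'a|aa']; last first.
    have {}aa' : a = a' by apply: val_inj => /=; lia.
    subst a'; apply: (D2 (sym a b') (sym a b)).
    + by rewrite rank_sym_lt; lia.
    + by rewrite rank_sym_le; lia.
    rewrite !Dword_val_cons !DvalM; try lia.
    rewrite (@gen_zxy b' a a) ?(@gen_zxy b a a); try lia.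
    by rewrite (@gen_zxy b' b a) ?(@gen_zyx b' b a) //; lia.
  case: (leqP b b') => bb'.
    apply: (D2 (sym a' b') (sym a b)).
    + by rewrite rank_sym_lt; lia.
    + by rewrite rank_sym_le; lia.
    rewrite !Dword_val_cons !DvalM; try lia.
    by rewrite [RHS]gen_zxy ?(@gen_zxy b b' a) //; lia.
  case: (ltngtP b a') => [ba''|a'b|/val_inj ba''].
  + apply: (D2 (sym a' b) (sym a b')).
    * by rewrite rank_sym_lt; lia.
    * by rewrite rank_sym_le; lia.
    rewrite !Dword_val_cons !DvalM; try lia.
    by rewrite [RHS]gen_zxy ?(@gen_zyx b' b a) //; lia.
  + apply: (D2 (sym b a') (sym a b')).
    * by rewrite rank_sym_lt; lia.
    * by rewrite rank_sym_le; lia.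
    rewrite !Dword_val_cons !DvalM; try lia.
    by rewrite [RHS]gen_zyx ?(@gen_zyx b' a' a) //; lia.
  + subst a'; apply: (D3 (sym b b) (sym b b) (sym a b')).
    * by rewrite rank_sym_lt; lia.
    * by rewrite rank_sym_le; lia.
    * by rewrite rank_sym_le; lia.
    rewrite !Dword_val_cons !Dval_diag !DvalM; try lia.
    by rewrite [RHS]gen_zxy ?(@gen_zyx b' b a) //; lia.
Qed.

(** * Termination and normal forms *)

(** The word chosen by [CSD] is the explicit one, by uniqueness. *)
Lemma CSD_pair d d' : ~ Dle d d' -> exists e v,
  [/\ CSD [:: d; d'] = e :: v, rank e < rank d
    & Dword_val (e :: v) = Dword_val [:: d; d']].
Proof.
move=> /staircase_pair_exists[e [v [lt stair val]]]; exists e, v; split=> //.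
rewrite /CSD; case: xgetP => [w _ [w_stair w_val]|/(_ (e :: v))[]]; last by split.
by apply: staircase_unique; rewrite ?val.
Qed.

Lemma rules_congruence v w :
  word_congruence (staircase_rules n) v w -> Dword_val v = Dword_val w.
Proof.
elim=> {v w} // [l r [d [d' [bad [-> ->]]]]|v u w _ -> _ -> //|v v' w w'].
  by have [e [v [-> _ ->]]] := CSD_pair bad.
by move=> _ vv' _ ww'; rewrite !Dword_val_cat vv' ww'.
Qed.

(** Reads a word as a number in base [(n * n).+1], its digits being the ranks of
its symbols; [N] is the exponent of the leading digit.  Aligning words on the
left makes the comparison lexicographic even when their lengths differ. *)
Fixpoint lex_code N w : nat :=
  if w is d :: w' then rank d * (n * n).+1 ^ N + lex_code N.-1 w' else 0.

Lemma lex_code_bound N w : size w <= N -> lex_code N w < (n * n).+1 ^ N.+1.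
Proof.
elim: w N => [|d w IHw] N /=; first by rewrite expn_gt0.
case: N => // N /IHw lt_w.
have := leq_mul (rank_bound d) (leqnn ((n * n).+1 ^ N.+1)).
by rewrite (expnS _ N.+1) !mulSn; move: lt_w => /=; lia.
Qed.

Lemma lex_code_lt N x d e v w : rank e < rank d ->
  size (x ++ e :: v) <= N ->
  lex_code N (x ++ e :: v) < lex_code N (x ++ d :: w).
Proof.
move=> ed; elim: x N => [|f x IHx] [|N] //= size_le; last first.
  by rewrite ltn_add2l IHx.
have := lex_code_bound size_le.
have := leq_mul ed (leqnn ((n * n).+1 ^ N.+1)).
by rewrite mulSn; lia.
Qed.

(** The exponent is the number of letters of the value: it bounds the length of
the word, and it is the same for all its reducts. *)
Definition staircase_code w := lex_code (size (spell w)) w.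

Lemma rewrites_to_code v w :
  rewrites_to (staircase_rules n) v w -> staircase_code w < staircase_code v.
Proof.
move=> vw; have /Dword_valP/chinese_perm/perm_size same_size :=
  rules_congruence (rewrites_to_congruence vw).
rewrite /staircase_code same_size; have := size_spell w.
case: vw => x [l [r [y [[d [d' [bad [-> ->]]]] -> ->]]]].
have [e [u [-> ed _]]] := CSD_pair bad.
by move=> size_w; apply: lex_code_lt.
Qed.

Lemma staircase_reducible w : ~ staircase w ->
  exists v, rewrites_to (staircase_rules n) w v.
Proof.
move=> stair; suff [x [d [d' [y [-> bad]]]]] :
    exists x d d' y, w = x ++ [:: d, d' & y] /\ ~ Dle d d'.
  exists (x ++ CSD [:: d; d'] ++ y), x, [:: d; d'], (CSD [:: d; d']), y.
  by split=> //; exists d, d'.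
have {stair} : ~~ sorted rle w by apply/negP=> /staircaseP.
elim: w => //= d [|d' w] //= IHw; rewrite negb_and => /orP[bad|/IHw].
  by exists [::], d, d', w; split=> //; apply/DleP/negP.
by move=> [x [e [e' [y [-> bad]]]]]; exists (d :: x), e, e', y.
Qed.

End Symbols.

(** * The presentation *)

Theorem theorem3p3 (n : nat) (n_ge1 : 1 <= n) :
  [/\ finite_set [set: Dsym n]%classic,
      finite_set (staircase_rules n),
      noetherian (staircase_rules n),
      confluent (staircase_rules n)
    & exists f : presented_monoid (staircase_rules n) -> chinese_monoid n,
        [/\ monoid_morphism f, bijective f
          & forall d : Dsym n, f (generator (staircase_rules n) d) = Dval d]].
Proof.
split.
- exact: finite_finset.
- apply: (@sub_finite_set _ _ (range (fun p : Dsym n * Dsym n =>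
      ([:: p.1; p.2], CSD [:: p.1; p.2])))).
    by move=> _ [d [d' [_ ->]]]; exists (d, d').
  exact/finite_image/finite_finset.
- exact: noetherian_measure (@rewrites_to_code n).
- by apply: (normal_forms_confluent (@rewrites_to_code n)
    (@staircase_reducible n) (@rules_congruence n) (@staircase_unique n)).
have sound := same_value_congruence (@rewrites_to_code n) (@staircase_reducible n)
  (@rules_congruence n) (@staircase_unique n).
pose f (p : presented_monoid (staircase_rules n)) := Dword_val (repr p).
have fE w : f (word_class _ w) = Dword_val w.
  by apply: rules_congruence; apply/word_classP; rewrite word_class_repr.
exists f; split; last by move=> d; rewrite fE /Dword_val big_seq1.
  split; first by rewrite [LHS]fE /Dword_val big_nil.
  move=> p q; rewrite -(word_class_repr p) -(word_class_repr q).
  by rewrite [X in f X]presented_mulE !fE Dword_val_cat.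
pose g (m : chinese_monoid n) := word_class (staircase_rules n)
  [seq d1 a | a <- repr (m : presented_monoid (chinese_relations n))].
have fg : cancel g f.
  move=> m; rewrite fE Dword_val_class -[RHS]word_class_repr; congr word_class.
  by rewrite /spell -map_comp; elim: (repr _) => //= a u ->.
exists g => // p; rewrite -[LHS]word_class_repr -[RHS]word_class_repr.
by apply/word_classP/sound; apply: fg.
Qed.
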